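(* Let $(X,\mathcal{A},\mu)$ be a measure space with $\mu(X)=\infty$. An ideal in $\mathcal{M}(X,\mathcal{A})$ is closed in the $m_{\mu,F}$-topology if and only if it is a $Z_{\mu,F}$-ideal.
   Context: $X$ is a non-empty set, $\mathcal{A}$ a $\sigma$-algebra on $X$, $\mu:\mathcal{A}\to[0,\infty]$ a measure. $\mathcal{M}(X,\mathcal{A})$ is the commutative ring of all measurable functions $X\to\mathbb{R}$ under pointwise operations. A $\mu$-finite set is a set $E\in\mathcal{A}$ with $\mu(E)<\infty$. A positive unit of $\mathcal{M}(X,\mathcal{A})$ is a $u\in\mathcal{M}(X,\mathcal{A})$ with $u(x)>0$ for all $x\in X$. The $m_{\mu,F}$-topology on $\mathcal{M}(X,\mathcal{A})$ has as open base the sets $m_{\mu,F}(f,u)=\{g\in\mathcal{M}(X,\mathcal{A}):$ there is a $\mu$-finite set $E$ with $|f(x)-g(x)|<u(x)$ for all $x\in X\setminus E\}$, $f\in\mathcal{M}(X,\mathcal{A})$, $u$ a positive unit. An ideal $I$ of $\mathcal{M}(X,\mathcal{A})$ (not necessarily proper) is a $Z_{\mu,F}$-ideal if whenever $f\in\mathcal{M}(X,\mathcal{A})$ and $g\in I$ satisfy $\mu(\{x\in X: f(x)\neq g(x)\})<\infty$, then $f\in I$; equivalently, whenever $f\in\mathcal{M}(X,\mathcal{A})$ and $\mu(\{x\in Z(g): f(x)\neq 0\})<\infty$ for some $g\in I$, then $f\in I$, where $Z(g)=\{x\in X: g(x)=0\}$. *)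

(* Defs.v *)
From HB Require Import structures.
From mathcomp Require Import all_boot all_order all_algebra.
From mathcomp Require Import all_classical all_reals all_analysis.
From mathcomp Require Import measurable_realfun lra.

Set Implicit Arguments.
Unset Strict Implicit.
Unset Printing Implicit Defensive.

Import Order.TTheory GRing.Theory Num.Theory.

Local Open Scope classical_set_scope.
Local Open Scope ring_scope.

(* Not necessarily proper, unlike [idealr_closed] of ring_quotient. *)
Definition is_ideal (A : comPzRingType) (I : set A) : Prop :=
  [/\ I 0,
      (forall f g, I f -> I g -> I (f + g)) &
      (forall f g, I g -> I (f * g))].

Section Defs.
Context d (T : measurableType d) (R : realType).
Variable mu : {measure set T -> \bar R}.

Definition mu_finite (E : set T) : Prop :=
  measurable E /\ (mu E < +oo)%E.

Definition positive_unit (u : {mfun T >-> R}) : Prop :=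
  forall x, 0 < u x.

Definition mmuF_base (f u : {mfun T >-> R}) : set {mfun T >-> R} :=
  [set g | exists2 E, mu_finite E & forall x, ~ E x -> `|f x - g x| < u x].

Definition ZmuF_ideal (I : set {mfun T >-> R}) : Prop :=
  is_ideal I /\
  forall f g : {mfun T >-> R}, I g ->
    (mu [set x | f x <> g x] < +oo)%E -> I f.

Lemma mu_finite0 : mu_finite set0.
Proof. by split => //; rewrite measure0 ltry. Qed.

Lemma mu_finiteU E F : mu_finite E -> mu_finite F -> mu_finite (E `|` F).
Proof.
move=> [mE fE] [mF fF]; split; first exact: measurableU.
by apply: le_lt_trans (measureU2 _ _ _) _ => //; exact: lte_add_pinfty.
Qed.

Lemma mmuF_base_refl f u : positive_unit u -> mmuF_base f u f.
Proof.
by move=> u0; exists set0; [exact: mu_finite0|move=> x _; rewrite subrr normr0].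
Qed.

Lemma mmuF_base_cover :
  \bigcup_(i in [set fu : {mfun T >-> R} * {mfun T >-> R} |
                 positive_unit fu.2])
     mmuF_base i.1 i.2 = setT.
Proof.
apply/seteqP; split => // f _; exists (f, 1) => /=.
  by move=> x; rewrite mfun1.
by apply: mmuF_base_refl => x; rewrite mfun1.
Qed.

Lemma mmuF_base_join (i j : {mfun T >-> R} * {mfun T >-> R}) h :
  positive_unit i.2 -> positive_unit j.2 ->
  mmuF_base i.1 i.2 h -> mmuF_base j.1 j.2 h ->
  exists k : {mfun T >-> R} * {mfun T >-> R},
    [/\ positive_unit k.2, mmuF_base k.1 k.2 h &
        mmuF_base k.1 k.2 `<=` mmuF_base i.1 i.2 `&` mmuF_base j.1 j.2].
Proof.
case: i j => [f u] [g v] /= u0 v0 [E fE uE] [F fF vF].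
pose k x := Num.min (u x - `|f x - h x|) (v x - `|g x - h x|).
pose w x := if 0 < k x then k x else 1.
have mk : measurable_fun setT k.
  apply: measurable_minr; apply: measurable_funB => //.
    by apply: measurableT_comp => //; exact: measurable_funB.
  by apply: measurableT_comp => //; exact: measurable_funB.
have mw : measurable_fun setT w.
  by apply: measurable_fun_ifT => //; exact: measurable_fun_ltr.
pose W : {mfun T >-> R} := mfun_Sub (mem_set mw).
have W0 : positive_unit W by move=> x; rewrite /= /w; case: ifPn.
exists (h, W); split => //=; first exact: mmuF_base_refl.
move=> z [G fG wG].
have key x : ~ (E `|` F `|` G) x ->
    `|f x - z x| < u x /\ `|g x - z x| < v x.
  move=> /not_orP[/not_orP[Ex Fx] Gx].
  have := wG x Gx; rewrite /= /w /k.
  rewrite lt_min !subr_gt0 (uE x Ex) (vF x Fx)/= lt_min => /andP[h1 h2].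
  split; [apply: le_lt_trans (ler_distD (h x) _ _) _
         |apply: le_lt_trans (ler_distD (h x) _ _) _]; lra.
have fEFG : mu_finite (E `|` F `|` G) by do 2?apply: mu_finiteU.
by split; exists (E `|` F `|` G) => // x /key[].
Qed.

End Defs.

(* M(X, A) endowed with the m_{mu,F}-topology; the alias, which depends on mu,
   keeps this topology from being inferred on {mfun T >-> R} itself. *)
Definition mmuF_space d (T : measurableType d) (R : realType)
  (mu : {measure set T -> \bar R}) : Type := {mfun T >-> R}.

HB.instance Definition _ d (T : measurableType d) (R : realType)
    (mu : {measure set T -> \bar R}) :=
  Choice.copy (mmuF_space mu) {mfun T >-> R}.

HB.instance Definition _ d (T : measurableType d) (R : realType)
    (mu : {measure set T -> \bar R}) :=
  isPointed.Build (mmuF_space mu) (0 : {mfun T >-> R}).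

HB.instance Definition _ d (T : measurableType d) (R : realType)
    (mu : {measure set T -> \bar R}) :=
  @isBaseTopological.Build (mmuF_space mu)
    (mmuF_space mu * mmuF_space mu)%type
    [set fu | positive_unit fu.2]
    (fun fu => mmuF_base mu fu.1 fu.2)
    (mmuF_base_cover mu) (@mmuF_base_join _ _ _ mu).

(* Main.v *)
(** Functions that differ only on a [mu]-finite set belong to the same basic
    open sets, so a closed ideal is a Z_{mu,F}-ideal. Conversely, if [f] lies
    in the closure of a Z_{mu,F}-ideal [I], take a positive unit [u] equal to
    [|f|] wherever [f] does not vanish, and [g] in [I] with [|f - g| < u]
    outside a [mu]-finite set [E]. Outside [E], [g x = 0] forces [f x = 0], so
    the element [(f / g) g] of [I] agrees with [f] there, and [f] is in [I]. *)

Require Import Defs.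
From mathcomp Require Import all_boot all_order all_algebra.
From mathcomp Require Import all_classical all_reals all_analysis.
From mathcomp Require Import measurable_realfun.

Local Open Scope classical_set_scope.
Local Open Scope ring_scope.

Import Order.TTheory GRing.Theory Num.Theory.
Import numFieldNormedType.Exports.

(** Inversion is continuous on the open complement of [0], and any function is measurable on a
    singleton, so the line is split at [0]. *)
Lemma measurable_invr (R : realType) : measurable_fun [set: R] (@GRing.inv R).
Proof.
rewrite -(setUv [set 0]).
apply/measurable_funU; [by []|exact: measurableC|split].
  exact: measurable_fun_set1.
apply: open_continuous_measurable_fun.
  exact/closed_openC/closed_eq.
by move=> x; rewrite inE => /eqP x0; exact: inv_continuous.
Qed.

Section mmuF_topology.
Context d (T : measurableType d) (R : realType).
Variable mu : {measure set T -> \bar R}.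
Implicit Types (f g u : {mfun T >-> R}) (I : set {mfun T >-> R}).

Lemma mmuF_base_open f u : positive_unit u ->
  open (mmuF_base mu f u : set (mmuF_space mu)).
Proof.
move=> u0; exists [set (f, u)]; first by move=> _ ->.
by rewrite bigcup_set1.
Qed.

Lemma mmuF_base_nbhs f u : positive_unit u ->
  nbhs (f : mmuF_space mu) (mmuF_base mu f u).
Proof.
move=> u0; apply: open_nbhs_nbhs; split; first exact: mmuF_base_open.
exact: mmuF_base_refl.
Qed.

(** The centre [hu.1] may differ from [f]: an open set is a union of basic sets, one of which
    contains [f]. *)
Lemma nbhs_mmuF_base f (B : set (mmuF_space mu)) :
  nbhs (f : mmuF_space mu) B ->
  exists2 hu : {mfun T >-> R} * {mfun T >-> R},
    mmuF_base mu hu.1 hu.2 f & mmuF_base mu hu.1 hu.2 `<=` B.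
Proof.
rewrite nbhsE => -[_ [[D _ <-] [hu Dhu hf]] UB].
by exists hu => // g hg; apply: UB; exists hu.
Qed.

Lemma measurable_mfun_neq f g : measurable [set x | f x <> g x].
Proof.
have -> : [set x | f x <> g x] =
    ~` (setT `&` (fun x => f x == g x) @^-1` [set true]).
  by rewrite setTI; apply/seteqP; split => x /= h /eqP.
by apply: measurableC; exact: measurable_fun_eqr.
Qed.

Lemma closed_ideal_ZmuF_ideal I : is_ideal I ->
  closed (I : set (mmuF_space mu)) -> ZmuF_ideal mu I.
Proof.
move=> idI clI; split=> // f g Ig fin; apply: clI => B /nbhs_mmuF_base.
move=> [[h u] /= [E finE hf] hB]; exists g; split=> //; apply: hB.
(* Adding the disagreement set to the exceptional set of [f] makes it serve for [g]. *)
exists (E `|` [set x | f x <> g x]).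
  by apply: mu_finiteU => //; split=> //; exact: measurable_mfun_neq.
move=> x /not_orP[/hf hfx /= nfg].
by have <- : f x = g x by exact: contrapT.
Qed.

Lemma exists_positive_unit_norm f :
  exists2 u, positive_unit u & forall x, f x != 0 -> u x = `|f x|.
Proof.
(* The value [1] keeps the function positive where [f] vanishes. *)
have mnorm : measurable_fun setT (fun x => if f x == 0 then 1 else `|f x|).
  apply: measurable_fun_ifT => //; first exact: measurable_fun_eqr.
  exact: measurableT_comp.
exists (mfun_Sub (mem_set mnorm)) => x /=; last by move/negPf ->.
by case: ifPn => //; rewrite normr_gt0.
Qed.

Lemma ZmuF_ideal_closed I : ZmuF_ideal mu I ->
  closed (I : set (mmuF_space mu)).
Proof.
move=> [[_ _ IM] ZI] f clf.
have [u u0 uE] := exists_positive_unit_norm f.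
have [g [Ig [E [mE finE] fgu]]] := clf _ (mmuF_base_nbhs f u u0).
(* As [0^-1 = 0], the quotient is defined everywhere, with value [0] on the zeros of [g]. *)
have mk : measurable_fun setT (fun x => f x / g x).
  apply: measurable_funM => //.
  by apply: measurableT_comp => //; exact: measurable_invr.
apply: (ZI f (mfun_Sub (mem_set mk) * g)); first exact: IM.
apply: le_lt_trans finE; apply: le_measure; rewrite ?inE //.
  exact: measurable_mfun_neq.
(* A disagreement at [x] forces [g x = 0] and [f x != 0], hence [u x = |f x - g x|], which is
   impossible outside [E]. *)
move=> x /= neq; apply: contrapT => /fgu; apply/negP; rewrite -leNgt.
have [g0|g0] := eqVneq (g x) 0; last by case: neq; rewrite -[RHS]/(f x / g x * g x) divfK.
have [f0|f0] := eqVneq (f x) 0; first by case: neq; rewrite -[RHS]/(f x / g x * g x) f0 mul0r mul0r.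
by rewrite g0 subr0 uE.
Qed.

End mmuF_topology.

Theorem corollary6p34 (d : measure_display) (T : measurableType d)
    (R : realType) (mu : {measure set T -> \bar R})
    (mu_infty : mu [set: T] = +oo%E)
    (I : set {mfun T >-> R}) (I_ideal : is_ideal I) :
  closed (I : set (mmuF_space mu)) <-> ZmuF_ideal mu I.
Proof.
split; first exact: closed_ideal_ZmuF_ideal.
exact: ZmuF_ideal_closed.
Qed.
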